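(* Let $\epsilon,\lambda,\tau,d_1,d_2>0$ and let $s^*=(u^*,v^*,p^* )$ be one of the constant limiting states $$(0,v^*,0)\ \text{with } v^*>0,\qquad (u^*,0,1)\ \text{with } u^*>0,\qquad (0,0,p_1)\ \text{with } p_1\in[0,1].$$ Consider the semi-discrete semi-implicit scheme for the linearization at $s^*$, for functions of $x\in\mathbb{R}^d$: $$\frac{p^{n+1}-p^n}{\tau}=\frac1\epsilon\left[(1-p^* )u^n-p^*v^n-(u^*+v^* )p^{n+1}\right],$$ $$\frac{u^{n+1}-u^n}{\tau}-d_1\Delta u^{n+1}=\frac1\epsilon\left[-(v^*+\lambda(1-p^* ))u^{n+1}-u^*v^n+\lambda u^*p^{n+1}\right],$$ $$\frac{v^{n+1}-v^n}{\tau}-d_2\Delta v^{n+1}=\frac1\epsilon\left[-v^*u^{n+1}-(u^*+\lambda p^* )v^{n+1}-\lambda v^*p^{n+1}\right].$$ Then the scheme is stable, i.e. it generates no unstable spatial modes: if $m\in\mathbb{R}^d$, $\mu\in\mathbb{C}$ and $(\alpha,\beta,\gamma)\in\mathbb{C}^3\setminus\{0\}$ are such that $$u^n(x)=\alpha\mu^n e^{i m\cdot x},\qquad v^n(x)=\beta\mu^n e^{i m\cdot x},\qquad p^n(x)=\gamma\mu^n e^{i m\cdot x}\qquad(n\ge 0)$$ solves the scheme, then the growth factor satisfies $|\mu|\le 1$.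
   Context: The linearized system is $\partial_t s-D\Delta s=J(s^* )s$ with $s=(u,v,p)'$, $D=\mathrm{diag}(d_1,d_2,0)$ and $$J(s^* )=\frac1\epsilon\begin{bmatrix}-v^*-\lambda(1-p^* )&-u^*&\lambda u^*\\-v^*&-(u^*+\lambda p^* )&-\lambda v^*\\1-p^*&-p^*&-(u^*+v^* )\end{bmatrix}.$$ It is the linearization at $s^*$ of the fast reaction--diffusion system $$\partial_t u-d_1\Delta u=-\tfrac1\epsilon u[v+\lambda(1-p)],\quad \partial_t v-d_2\Delta v=-\tfrac1\epsilon v(u+\lambda p),\quad \partial_t p=\tfrac1\epsilon[(1-p)u-vp].$$ The states $s^*$ in the claim are the possible spatially homogeneous values of the limit as $\epsilon\to0$. The time step is $\tau>0$. Stability is meant in the sense of von Neumann (growth factors of Fourier modes of modulus at most $1$). *)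

(* Defs.v *)
From HB Require Import structures.
From mathcomp Require Import all_boot all_order all_algebra.
From mathcomp.real_closed Require Import complex.
From mathcomp Require Import all_classical all_reals all_analysis.
Set Implicit Arguments.
Unset Strict Implicit.
Unset Printing Implicit Defensive.
Import Order.TTheory GRing.Theory Num.Theory.
Import numFieldNormedType.Exports.
Local Open Scope ring_scope.
Local Open Scope complex_scope.

Definition dotv (R : realType) (d : nat) (m x : 'rV[R]_d) : R :=
  \sum_(j < d) m ord0 j * x ord0 j.

(* e^{i t} for real t *)
Definition expi (R : realType) (t : R) : R[i] := cos t +i* sin t.

Definition laplacian (R : realType) (d : nat) (f : 'rV[R]_d -> R)
    (x : 'rV[R]_d) : R :=
  \sum_(j < d)
    'D_(delta_mx ord0 j) (fun y => 'D_(delta_mx ord0 j) f y) x.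

(* A complex-valued function of a real vector is differentiated through its
   real and imaginary parts.  The library derivative is total, so this is the
   usual Laplacian only where the second partial derivatives exist; this is
   the case for plane waves, which are smooth. *)
Definition claplacian (R : realType) (d : nat) (f : 'rV[R]_d -> R[i])
    (x : 'rV[R]_d) : R[i] :=
  laplacian (fun y => complex.Re (f y)) x
    +i* laplacian (fun y => complex.Im (f y)) x.

Definition limiting_state (R : realType) (us vs ps : R) : Prop :=
  [\/ [/\ us = 0, 0 < vs & ps = 0],
      [/\ 0 < us, vs = 0 & ps = 1]
    | [/\ us = 0, vs = 0 & 0 <= ps <= 1]].

Definition solves_scheme (R : realType) (d : nat)
    (eps lambda tau d1 d2 us vs ps : R)
    (u v p : nat -> 'rV[R]_d -> R[i]) : Prop :=
  forall (n : nat) (x : 'rV[R]_d),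
  [/\ (p n.+1 x - p n x) / tau%:C =
        (eps^-1)%:C * ((1 - ps)%:C * u n x - ps%:C * v n x
                       - (us + vs)%:C * p n.+1 x),
      (u n.+1 x - u n x) / tau%:C - d1%:C * claplacian (u n.+1) x =
        (eps^-1)%:C * (- (vs + lambda * (1 - ps))%:C * u n.+1 x
                       - us%:C * v n x
                       + (lambda * us)%:C * p n.+1 x)
    & (v n.+1 x - v n x) / tau%:C - d2%:C * claplacian (v n.+1) x =
        (eps^-1)%:C * (- vs%:C * u n.+1 x
                       - (us + lambda * ps)%:C * v n.+1 x
                       - (lambda * vs)%:C * p n.+1 x)].

Definition fourier_mode (R : realType) (d : nat) (a mu : R[i])
    (m : 'rV[R]_d) (n : nat) (x : 'rV[R]_d) : R[i] :=
  a * mu ^+ n * expi (dotv m x).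

(* Von Neumann stability: no Fourier mode solving the scheme is amplified.
   The norm on R[i] takes its values in R[i] (as a real element). *)
Definition von_neumann_stable (R : realType) (d : nat)
    (scheme : (nat -> 'rV[R]_d -> R[i]) -> (nat -> 'rV[R]_d -> R[i]) ->
              (nat -> 'rV[R]_d -> R[i]) -> Prop) : Prop :=
  forall (m : 'rV[R]_d) (mu alpha beta gamma : R[i]),
    (alpha, beta, gamma) <> (0, 0, 0) ->
    scheme (fourier_mode alpha mu m) (fourier_mode beta mu m)
           (fourier_mode gamma mu m) ->
    `|mu| <= 1.

(* Main.v *)
Require Import Defs.
From mathcomp Require Import all_boot all_order all_algebra.
From mathcomp.real_closed Require Import complex.
From mathcomp Require Import all_classical all_reals all_analysis.
From mathcomp Require Import ring.
Local Open Scope ring_scope.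
Import Order.TTheory GRing.Theory Num.Theory.
Import numFieldNormedType.Exports.
Local Open Scope complex_scope.

(** Plane waves are eigenfunctions of the Laplacian, so the scheme acts on the
    amplitudes (alpha, beta, gamma) of a Fourier mode by a 3 x 3 linear system
    whose coefficients involve the eigenvalue - |m|^2.  At each of the limiting
    states enough entries of the linearization vanish for this system to be
    triangular:
    - at (0, v, 0), alpha evolves alone, it drives gamma, and both drive beta;
    - at (u, 0, 1), beta evolves alone, it drives gamma, and both drive alpha;
    - at (0, 0, p), alpha and beta evolve alone, and both drive gamma.
    The first nonzero amplitude in this order therefore satisfies a decoupled
    scalar recurrence.  Diffusion and diagonal reaction are both damping and
    both taken implicitly, so that recurrence is a backward Euler step
    (z mu - z) / tau + c z mu = 0 with c >= 0, which gives
    mu = 1 / (1 + tau c) and hence |mu| <= 1 ([backward_euler_stable]). *)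

(** Reduces directional derivatives to derivatives of functions of one real
    variable: both sides are limits of the same difference quotient. *)
Lemma derive_line (R : realType) (d : nat) (f : 'rV[R]_d -> R)
    (x v : 'rV[R]_d) :
  'D_v f x = 'D_1 (fun h : R => f (h *: v + x)) 0.
Proof.
rewrite /derive.
set F := (X in _ = lim (X @ _)%classic).
rewrite (_ : F = (fun h : R => h^-1 *: (f (h *: v + x) - f x))) //.
by apply/funext => h; rewrite /F /= scale0r add0r addr0 [h *: 1]mulr1.
Qed.

Lemma dotv_line (R : realType) (d : nat) (m x : 'rV[R]_d) (j : 'I_d) (h : R) :
  dotv m (h *: delta_mx ord0 j + x) = h * m ord0 j + dotv m x.
Proof.
rewrite /dotv (eq_bigr (fun i => h * m ord0 i * (i == j)%:R
                                 + m ord0 i * x ord0 i)); last first.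
  by move=> i _; rewrite !mxE eqxx /=; ring.
rewrite big_split /=; congr (_ + _).
rewrite (bigD1 j) //= eqxx mulr1 big1 ?addr0 // => i /negPf ->.
by rewrite mulr0.
Qed.

(** Combinations of cosine and sine, rather than the two functions separately,
    because this family is stable under differentiation. *)
Definition real_wave (R : realType) (d : nat) (m : 'rV[R]_d) (A B : R)
    (y : 'rV[R]_d) : R :=
  A * cos (dotv m y) + B * sin (dotv m y).

Lemma derive_real_wave (R : realType) (d : nat) (m : 'rV[R]_d) (A B : R)
    (j : 'I_d) (x : 'rV[R]_d) :
  'D_(delta_mx ord0 j) (real_wave R d m A B) x =
  real_wave R d m (m ord0 j * B) (- (m ord0 j * A)) x.
Proof.
rewrite derive_line /real_wave.
under eq_fun do rewrite dotv_line.
set c := m ord0 j; set t := dotv m x.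
have Dl : is_derive (0 : R) (1 : R) (fun h : R => h * c + t) c.
  by apply: is_derive_eq; rewrite addr0 scaler0 add0r [_ *: _]mulr1.
have Dcos : is_derive (0 : R) (1 : R) (fun h : R => cos (h * c + t)) (- sin t * c).
  have := @is_derive1_comp R cos (fun h : R => h * c + t) 0 (- sin t) c.
  by apply => //=; rewrite mul0r add0r; exact: is_derive_cos.
have Dsin : is_derive (0 : R) (1 : R) (fun h : R => sin (h * c + t)) (cos t * c).
  have := @is_derive1_comp R sin (fun h : R => h * c + t) 0 (cos t) c.
  by apply => //=; rewrite mul0r add0r; exact: is_derive_sin.
have D := is_deriveD (is_deriveZ A Dcos) (is_deriveZ B Dsin).
rewrite (@derive_val _ _ _ _ _ _ _ D) /GRing.scale /=; ring.
Qed.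

Lemma laplacian_real_wave (R : realType) (d : nat) (m : 'rV[R]_d) (A B : R)
    (x : 'rV[R]_d) :
  laplacian (real_wave R d m A B) x = - dotv m m * real_wave R d m A B x.
Proof.
rewrite /laplacian /dotv -sumrN mulr_suml; apply: eq_bigr => j _.
under eq_fun do rewrite derive_real_wave.
rewrite derive_real_wave /real_wave; ring.
Qed.

Lemma claplacian_fourier_mode (R : realType) (d : nat) (a mu : R[i])
    (m : 'rV[R]_d) (n : nat) (x : 'rV[R]_d) :
  claplacian (fourier_mode a mu m n) x =
  - (dotv m m)%:C * fourier_mode a mu m n x.
Proof.
rewrite /claplacian /fourier_mode; move: (a * mu ^+ n) => [A B].
rewrite (_ : (fun y => complex.Re _) = real_wave R d m A (- B)); last first.
  by apply/funext => y; rewrite /real_wave /=; ring.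
rewrite (_ : (fun y => complex.Im _) = real_wave R d m B A); last first.
  by apply/funext => y; rewrite /real_wave /=; ring.
rewrite !laplacian_real_wave /real_wave.
by apply/eqP; rewrite eq_complex /=; apply/andP; split; apply/eqP; ring.
Qed.

Lemma dotv_ge0 (R : realType) (d : nat) (m : 'rV[R]_d) : 0 <= dotv m m.
Proof. by apply: sumr_ge0 => j _; rewrite -expr2 sqr_ge0. Qed.

(** The relation says mu (1 + tau c) = 1, and 1 + tau c >= 1. *)
Lemma backward_euler_stable (R : realType) (tau c : R) (mu z : R[i]) :
  0 < tau -> 0 <= c -> z != 0 ->
  (z * mu - z) / tau%:C + c%:C * (z * mu) = 0 -> `|mu| <= 1.
Proof.
move=> tau0 c0 z0 E.
have tauC0 : tau%:C != 0 by rewrite eq_complex /= eqxx andbT gt_eqF.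
have muE : mu * (1 + tau * c)%:C = 1.
  apply: (mulfI z0); apply/eqP; rewrite -subr_eq0; apply/eqP.
  transitivity (tau%:C * ((z * mu - z) / tau%:C + c%:C * (z * mu))).
    by field.
  by rewrite E mulr0.
have ge1 : 1 <= (1 + tau * c)%:C.
  by rewrite lecR lerDl mulr_ge0 // ltW.
rewrite -[1 in X in _ <= X]normr1 -muE normrM.
rewrite ler_peMr // ger0_norm //; exact: le_trans ge1.
Qed.

(** Evaluating at the origin loses nothing, since all terms of the scheme carry
    the same factor e^{i m.x}; the step from n = 0 avoids dividing by a power
    of mu. *)
Lemma modal_system (R : realType) (d : nat)
    (eps lambda tau d1 d2 us vs ps : R) (m : 'rV[R]_d)
    (mu alpha beta gamma : R[i]) :
  solves_scheme eps lambda tau d1 d2 us vs ps (fourier_mode alpha mu m)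
    (fourier_mode beta mu m) (fourier_mode gamma mu m) ->
  let k := eps^-1 in let q := dotv m m in
  [/\ (gamma * mu - gamma) / tau%:C + (k * (us + vs))%:C * (gamma * mu) =
        k%:C * ((1 - ps)%:C * alpha - ps%:C * beta),
      (alpha * mu - alpha) / tau%:C
        + (d1 * q + k * (vs + lambda * (1 - ps)))%:C * (alpha * mu) =
        (k * us)%:C * (lambda%:C * (gamma * mu) - beta)
    & (beta * mu - beta) / tau%:C
        + (d2 * q + k * (us + lambda * ps))%:C * (beta * mu) =
        - (k * vs)%:C * (alpha * mu + lambda%:C * (gamma * mu))].
Proof.
move=> /(_ 0%N 0) H k q; move: H; rewrite !claplacian_fourier_mode.
have e0 : expi (dotv m 0) = 1 :> R[i].
  by rewrite /dotv big1 ?/expi ?cos0 ?sin0 // => j _; rewrite mxE mulr0.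
rewrite /fourier_mode e0 expr0 expr1 !mulr1 -/k -/q => -[Hp Hu Hv].
split.
- apply/eqP; rewrite addrC eq_sym -subr_eq eq_sym addrC; apply/eqP.
  rewrite Hp; ring.
- apply/eqP; rewrite -subr_eq0; apply/eqP; move/eqP: Hu; rewrite -subr_eq0.
  move=> /eqP <-; ring.
- apply/eqP; rewrite -subr_eq0; apply/eqP; move/eqP: Hv; rewrite -subr_eq0.
  move=> /eqP <-; ring.
Qed.

Theorem lemma2p3 (R : realType) (d : nat)
    (eps lambda tau d1 d2 us vs ps : R)
    (eps_gt0 : 0 < eps) (lambda_gt0 : 0 < lambda) (tau_gt0 : 0 < tau)
    (d1_gt0 : 0 < d1) (d2_gt0 : 0 < d2)
    (state : limiting_state us vs ps) :
  von_neumann_stable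
    (@solves_scheme R d eps lambda tau d1 d2 us vs ps).
Proof.
move=> m mu alpha beta gamma nz /modal_system /=.
have [us0 vs0 ps01] : [/\ 0 <= us, 0 <= vs & 0 <= ps <= 1].
  case: state => [[-> /ltW ? ->]|[/ltW ? -> ->]|[-> -> ?]];
  by rewrite ?lexx ?ler01.
have /andP[ps0 ps1] := ps01.
set k := eps^-1; set q := dotv m m.
have k0 : 0 <= k by rewrite invr_ge0 ltW.
have q0 : 0 <= q by exact: dotv_ge0.
have [l0 d10 d20] : [/\ 0 <= lambda, 0 <= d1 & 0 <= d2] by split; exact: ltW.
have cp0 : 0 <= k * (us + vs) by rewrite mulr_ge0 ?addr_ge0.
have cu0 : 0 <= d1 * q + k * (vs + lambda * (1 - ps)).
  by rewrite addr_ge0 ?mulr_ge0 ?addr_ge0 ?mulr_ge0 ?subr_ge0.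
have cv0 : 0 <= d2 * q + k * (us + lambda * ps).
  by rewrite addr_ge0 ?mulr_ge0 ?addr_ge0 ?mulr_ge0.
move: cp0 cu0 cv0; set cp := k * _; set cu := d1 * _ + _; set cv := d2 * _ + _.
move=> cp0 cu0 cv0 [Hp Hu Hv].
have stable := @backward_euler_stable R tau _ mu _ tau_gt0.
case: state => [[us_eq _ ps_eq]|[_ vs_eq ps_eq]|[us_eq vs_eq _]].
- have [a0|a0] := eqVneq alpha 0; last first.
    by apply: (stable _ _ cu0 a0); rewrite Hu us_eq mulr0 mul0r.
  have [g0|g0] := eqVneq gamma 0; last first.
    by apply: (stable _ _ cp0 g0); rewrite Hp a0 ps_eq mulr0 mul0r subrr mulr0.
  have [b0|b0] := eqVneq beta 0; first by case: nz; rewrite a0 b0 g0.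
  by apply: (stable _ _ cv0 b0); rewrite Hv a0 g0 mul0r mulr0 addr0 mulr0.
- have [b0|b0] := eqVneq beta 0; last first.
    by apply: (stable _ _ cv0 b0); rewrite Hv vs_eq mulr0 oppr0 mul0r.
  have [g0|g0] := eqVneq gamma 0; last first.
    apply: (stable _ _ cp0 g0).
    by rewrite Hp b0 ps_eq subrr mul0r mulr0 subrr mulr0.
  have [a0|a0] := eqVneq alpha 0; first by case: nz; rewrite a0 b0 g0.
  by apply: (stable _ _ cu0 a0); rewrite Hu b0 g0 mul0r mulr0 subrr mulr0.
- have [a0|a0] := eqVneq alpha 0; last first.
    by apply: (stable _ _ cu0 a0); rewrite Hu us_eq mulr0 mul0r.
  have [b0|b0] := eqVneq beta 0; last first.
    by apply: (stable _ _ cv0 b0); rewrite Hv vs_eq mulr0 oppr0 mul0r.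
  have [g0|g0] := eqVneq gamma 0; first by case: nz; rewrite a0 b0 g0.
  by apply: (stable _ _ cp0 g0); rewrite Hp a0 b0 !mulr0 subrr mulr0.
Qed.
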